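(* For every positive integer $d$ there is a constant $C_d>0$ such that the following holds. Let $n,r$ be positive integers and $\ell=\lceil d/r\rceil$. For $N\ge r^{r^{C_d r n^{d}}}$, every $r$-colouring of the edges of $\square^{d}K_N$ contains a monochromatic copy of $\square^{\ell}K_n$. The value of $\ell$ is tight.
   Context: For a positive integer $N$, $[N]=\{1,\dots,N\}$, and $K_N$ is the complete graph on vertex set $[N]$. The Cartesian product $\square^{d}K_N$ of $d$ copies of $K_N$ is the graph with vertex set $[N]^d$ in which two vertices are adjacent if and only if they differ in exactly one coordinate. A copy of $\square^{\ell}K_n$ in $\square^{d}K_N$ means a sub-product: the subgraph induced on $A_1\times\dots\times A_d$ where, for some set $I\subseteq\{1,\dots,d\}$ with $|I|=\ell$, $A_i\subseteq[N]$ has $|A_i|=n$ for $i\in I$ and $|A_i|=1$ for $i\notin I$. A copy is monochromatic if all its edges have the same colour. An $r$-colouring is an arbitrary assignment of one of $r$ colours to each edge. Tightness of $\ell$ means that if one demands a monochromatic copy of $\square^{\ell}K_n$ in every $r$-colouring of the edges of $\square^{d}K_N$, then $\ell$ must be at most $\lceil d/r\rceil$.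
   Formalization: For r=1 the bound on N is just 1 and the claim fails when N<n, so N≥n is also assumed when r=1; tightness of ℓ is stated for n≥2, since for n=1 a copy is a single vertex without edges and tightness fails for d,r≥2. *)

(* Defs.v *)
From mathcomp Require Import all_boot.

Set Implicit Arguments.
Unset Strict Implicit.
Unset Printing Implicit Defensive.

Definition vertex (d N : nat) := {ffun 'I_d -> 'I_N}.

Definition adjacent (d N : nat) (u v : vertex d N) : bool :=
  #|[set i | u i != v i]| == 1.

Definition edges (d N : nat) : {set {set vertex d N}} :=
  [set [set p.1; p.2] | p : vertex d N * vertex d N & adjacent p.1 p.2].

Definition edge (d N : nat) := {e : {set vertex d N} | e \in edges d N}.

Definition coloring (d N r : nat) := edge d N -> 'I_r.

Definition box (d N : nat) (A : 'I_d -> {set 'I_N}) : {set vertex d N} :=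
  [set u : vertex d N | [forall i, u i \in A i]].

(* [S] is the vertex set of a copy of the [l]-fold product of [K_n]; the copy
   itself is the subgraph induced on [S]. *)
Definition is_copy (d N l n : nat) (S : {set vertex d N}) : Prop :=
  exists (I : {set 'I_d}) (A : 'I_d -> {set 'I_N}),
    [/\ #|I| = l,
        forall i, #|A i| = if i \in I then n else 1
      & S = box A].

(* An edge belongs to the subgraph induced on [S] when both its endpoints do. *)
Definition monochromatic (d N r : nat) (c : coloring d N r)
    (S : {set vertex d N}) : Prop :=
  forall e f : edge d N, val e \subset S -> val f \subset S -> c e = c f.

Definition every_coloring_has_mono_copy (d N r l n : nat) : Prop :=
  forall c : coloring d N r,
    exists2 S : {set vertex d N}, is_copy l n S & monochromatic c S.

(* Main.v *)
Require Import Defs.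
From mathcomp Require Import all_boot all_order all_algebra.
From mathcomp Require Import reals exp zify.
Import Order.TTheory GRing.Theory Num.Theory.
Local Open Scope ring_scope.

(** For one colour everything is monochromatic.  Let r >= 2.  The upper bound is
    a two-stage reduction to boxes on which the colouring becomes simpler.

    In the first stage ([monotone_box]) one finds a box of side t on which the
    colour of an edge in direction i depends only on i and on its lower endpoint.
    For a single coordinate this is the classical argument of Erdős and Rado,
    which costs only a single exponential in t ([monotone_ramsey]).  On such a
    box every vertex w carries a vector in [r]^d, whose i-th entry is the common
    colour of the edges going up from w in direction i.  An edge colouring has
    thus become a vertex colouring with r^d colours.

    In the second stage ([constant_subbox]) one finds inside it a sub-box of side
    n on which this vector is constant, say equal to kappa; this is possible once
    t is at least (r^d n)^((n+1)^(d-1)).  On the sub-box all edges in direction i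
    have colour kappa i ([canonical_box]).  By pigeonhole kappa takes the same value
    on some ceil(d/r) directions, and fixing the other coordinates gives the
    monochromatic copy ([mono_copy_of_canonical]).

    Both stages handle the coordinates one at a time by the same pigeonhole
    scheme ([sequential_choice]): if for every value of coordinate i the
    coordinates before i have been dealt with, by a choice of sets that takes few
    values, then many values of coordinate i lead to the same choice, and on these
    values one argues in coordinate i alone.  The side t is r to a power O(n^d),
    and the monotone stage needs N to be r to a power polynomial in t, whence the
    double exponential bound ([tower_bound]).

    For tightness, colour an edge in direction i by i mod r.  A monochromatic copy
    only uses directions in one residue class, and such a class has at most
    ceil(d/r) elements ([mono_copy_dim_le]). *)

Section Boxes.
Local Open Scope nat_scope.
Set Implicit Arguments.
Unset Strict Implicit.
Unset Printing Implicit Defensive.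

(** * Pigeonhole and monotone colourings of a complete graph *)

Lemma leq_bin_expn n k : 'C(n, k) <= n ^ k.
Proof.
have ffact_le : n ^_ k <= n ^ k.
  elim: k => // k IH; rewrite ffactnSr expnSr.
  by apply: leq_mul => //; apply: leq_subr.
by apply: leq_trans ffact_le; rewrite -bin_ffact leq_pmulr // fact_gt0.
Qed.

Lemma subset_of_card (T : finType) (S : {set T}) m :
  m <= #|S| -> exists2 X : {set T}, X \subset S & #|X| = m.
Proof.
rewrite -bin_gt0 -cards_draws => /card_gt0P[X].
by rewrite inE => /andP[XS /eqP cX]; exists X.
Qed.

Lemma pigeonhole (T U : finType) (f : T -> U) (D : {set T}) (L : {set U}) m :
    (forall x, x \in D -> f x \in L) -> #|L| * m < #|D| ->
  exists2 y, y \in L & m < #|[set x in D | f x == y]|.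
Proof.
move=> fDL; rewrite ltnNge => /negP LD; apply/exists_inP; apply: contraT => noy.
case: LD; rewrite -sum1_card (partition_big f (mem L)) //= -sum_nat_const.
apply: leq_sum => y yL; move/exists_inPn: noy => /(_ y yL); rewrite -leqNgt.
by apply: leq_trans; rewrite -sum1_card; under [X in _ <= X]eq_bigl do rewrite inE.
Qed.

(** Take the least point a of S, keep the largest class of later points with
    respect to the colour of their edge to a, and repeat in that class.  Each step
    divides the number of points by k only, so t points cost k^t; asking for a
    monochromatic clique instead would cost an exponent proportional to k.
    The bound k is at least 2 even if there is one colour, so as to pay for the
    point a itself. *)
Lemma monotone_ramsey N (Q : finType) (f : 'I_N -> 'I_N -> Q) k t (S : {set 'I_N}) :
    1 < k -> #|Q| <= k -> k ^ t <= #|S| ->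
  exists X : {set 'I_N}, [/\ X \subset S, #|X| = t &
    forall a b b', a \in X -> b \in X -> b' \in X -> a < b -> a < b' ->
      f a b = f a b'].
Proof.
move=> k_gt1 Qk; elim: t S => [|t IH] S kS.
  by exists set0; split=> [||a b b']; rewrite ?sub0set ?cards0 ?inE.
have kt0 : 0 < k ^ t by rewrite expn_gt0 ltnW.
have /card_gt0P[a0 a0S] : 0 < #|S| by apply: leq_trans kS; rewrite expn_gt0 ltnW.
case: (arg_minnP (fun a : 'I_N => a : nat) a0S) => a /= aS amin.
have [y _ ySa] : exists2 y, y \in [set: Q] &
    (k ^ t).-1 < #|[set x in S :\ a | f a x == y]|.
  apply: pigeonhole => [x _|]; first by rewrite inE.
  rewrite cardsT; move: kS; rewrite (cardsD1 a) (aS : a \in S) expnS.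
  move=> kS; apply: (@leq_ltn_trans (k * (k ^ t).-1)).
    by rewrite leq_mul2r Qk orbT.
  move: kS (leq_pmulr k kt0); rewrite -subn1 mulnBr muln1 /=.
  by move: (k * k ^ t) (#|_|) => x y; lia.
have [|X [XS cX homX]] := IH [set x in S :\ a | f a x == y].
  by rewrite -(prednK kt0).
have XP b : b \in X -> [/\ b != a, b \in S & f a b = y].
  by move/(subsetP XS); rewrite !inE => /andP[/andP[-> ->] /eqP].
have aX : a \notin X by apply/negP => /XP[]; rewrite eqxx.
exists (a |: X); split.
- apply/subsetP => b; rewrite !inE => /orP[/eqP->//|/XP[]//].
- by rewrite cardsU1 aX cX.
have minX b c : c \in a |: X -> b \in a |: X -> c < b -> b \in X.
  rewrite !inE => caX /orP[/eqP->|//] ca; case/orP: caX => [/eqP ca'|].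
    by rewrite ca' ltnn in ca.
  by case/XP => _ /amin; rewrite leqNgt ca.
move=> c b b' cX' bX bX' cb cb'.
have {}bX := minX _ _ cX' bX cb; have {}bX' := minX _ _ cX' bX' cb'.
move: cX'; rewrite !inE => /orP[/eqP->|cX']; last exact: homX.
by have [_ _ ->] := XP _ bX; have [_ _ ->] := XP _ bX'.
Qed.

(** * Choosing a box one coordinate at a time *)

Definition upd d (T : Type) (u : {ffun 'I_d -> T}) (i : 'I_d) (x : T) :
  {ffun 'I_d -> T} := [ffun k => if k == i then x else u k].

(** The part of a box that is visible when only the coordinates before j have
    been treated: the others are still those of u. *)
Definition subcube d N (j : nat) (A : {ffun 'I_d -> {set 'I_N}}) (u : vertex d N) :
  {set vertex d N} := box (fun k => if k < j then A k else [set u k]).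

Lemma subcubeP d N j (A : {ffun 'I_d -> {set 'I_N}}) (u w : vertex d N) :
  reflect (forall k, w k \in if k < j then A k else [set u k])
          (w \in subcube j A u).
Proof. by rewrite inE; apply: forallP. Qed.

Lemma subcube_upd d N (i : 'I_d) (A : {ffun 'I_d -> {set 'I_N}}) X (u w : vertex d N) :
  w \in subcube i.+1 (upd A i X) u ->
  w i \in X /\ w \in subcube i A (upd u i (w i)).
Proof.
move/subcubeP=> wA; split; first by move: (wA i); rewrite ltnSn ffunE eqxx.
apply/subcubeP => k; move: (wA k); rewrite !ffunE ltnS.
case: (eqVneq k i) => [->|ki]; first by rewrite ltnn inE eqxx.
by rewrite leq_eqVlt -val_eqE /= in ki *; rewrite (negPf ki).
Qed.

Lemma subcube_all d N (A : {ffun 'I_d -> {set 'I_N}}) (u : vertex d N) :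
  subcube d A u = box A.
Proof. by apply/setP => w; rewrite !inE; apply: eq_forallb => k; rewrite ltn_ord. Qed.

Lemma card_box d N (A : 'I_d -> {set 'I_N}) m :
  (forall k, #|A k| <= m) -> #|box A| <= m ^ d.
Proof.
move=> Am; rewrite (@eq_card _ _ (mem (family (fun k => mem (A k))))); last first.
  by move=> w; rewrite inE.
rewrite card_family -[X in _ ^ X](size_enum_ord d) /image_mem.
elim: (enum 'I_d) => //= k s IH; rewrite expnS; exact: leq_mul.
Qed.

(** The predicate P j u A says that the sets A k with k < j do what is wanted on
    [subcube j A u].  The point of the induction is that for each j all vertices u
    are served by a small family L of choices.  Restricting coordinate k to a set
    D k of prescribed size bounds L: with B_i = m^((s+1)^i) the size of D i, the
    family for the coordinates before i has at most B_0^s ... B_{i-1}^s = B_i / m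
    members, so among the B_i values of coordinate i at least m lead to the same
    member A, which is what the step needs. *)
Lemma sequential_choice d N s m (D : 'I_d -> {set 'I_N})
    (P : nat -> vertex d N -> {ffun 'I_d -> {set 'I_N}} -> Prop) :
    0 < m -> (forall i, #|D i| = m ^ (s.+1 ^ i)) ->
    (forall u A, P 0 u A) ->
    (forall (i : 'I_d) u (A : {ffun 'I_d -> {set 'I_N}}) (S : {set 'I_N}),
      S \subset D i -> m <= #|S| ->
      (forall k : 'I_d, k < i -> A k \subset D k /\ #|A k| = s) ->
      (forall x, x \in S -> P i (upd u i x) A) ->
      exists X : {set 'I_N}, [/\ X \subset S, #|X| = s & P i.+1 u (upd A i X)]) ->
  forall u, exists A : {ffun 'I_d -> {set 'I_N}},
    (forall k, A k \subset D k /\ #|A k| = s) /\ P d u A.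
Proof.
move=> m_gt0 cD P0 step.
pose fits j (A : {ffun 'I_d -> {set 'I_N}}) :=
  forall k : 'I_d, k < j -> A k \subset D k /\ #|A k| = s.
have main j : j <= d -> exists L : {set {ffun 'I_d -> {set 'I_N}}},
    #|L| * m <= m ^ (s.+1 ^ j) /\
    forall u, exists A, [/\ A \in L, fits j A & P j u A].
  elim: j => [_|j IH jd].
    exists [set [ffun=> set0]]; rewrite cards1 mul1n; split=> // u.
    by exists [ffun=> set0]; split; rewrite ?inE.
  have [L [cL Lok]] := IH (ltnW jd); pose i := Ordinal jd.
  pose K := [set X : {set 'I_N} | X \subset D i & #|X| == s].
  exists [set upd A i X | A in L, X in K]; split.
    rewrite curry_imset2X.
    have := leq_imset_card (uncurry (fun A X => upd A i X)) (setX L K).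
    rewrite cardsX cards_draws cD /= => le1.
    apply: (@leq_trans (#|L| * 'C(m ^ s.+1 ^ j, s) * m)).
      by rewrite leq_mul2r le1 orbT.
    rewrite mulnAC expnSr expnM expnS.
    by apply: leq_mul => //; apply: leq_bin_expn.
  move=> u; have [F Fok] := fin_all_exists (fun x => Lok (upd u i x)).
  have [A AL SA] : exists2 A, A \in L &
      m.-1 < #|[set x in D i | F x == A]|.
    apply: pigeonhole => [x _|]; first by case: (Fok x).
    rewrite cD /=; apply: leq_trans cL.
    have : 0 < #|L| by apply/card_gt0P; have [A []] := Lok u; exists A.
    by rewrite -[in X in _ -> X](prednK m_gt0) mulnS /=; lia.
  set S := [set x in D i | F x == A] in SA.
  have SP x : x \in S -> [/\ x \in D i, fits j A & P j (upd u i x) A].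
    by rewrite inE => /andP[xD /eqP <-]; case: (Fok x).
  rewrite prednK // in SA.
  have fA : fits j A.
    by have /card_gt0P[x /SP[]] : 0 < #|S| by apply: leq_trans SA.
  have SD : S \subset D i by apply/subsetP => x /SP[].
  have [|X [XS cX PX]] := step i u A S SD SA fA; first by move=> x /SP[].
  exists (upd A i X); split=> //.
    apply: imset2_f => //; rewrite inE cX eqxx andbT; exact: subset_trans SD.
  move=> k kj; rewrite ffunE; case: eqVneq => [->|ki].
    by split=> //; exact: subset_trans SD.
  by apply: fA; move: ki; rewrite -val_eqE /= => ki; rewrite ltn_neqAle ki -ltnS.
have [L [_ Lok]] := main d (leqnn d).
move=> u; have [A [_ fA PA]] := Lok u; exists A; split=> // k; exact: fA.
Qed.

(** * Boxes with canonical edge colours *)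

Lemma subcube_card d N (i : 'I_d) (A : {ffun 'I_d -> {set 'I_N}}) (u : vertex d N) t :
  0 < t -> (forall k : 'I_d, k < i -> #|A k| = t) -> #|subcube i A u| <= t ^ d.
Proof.
move=> t_gt0 cA; apply: card_box => k.
by case: ifP => [/cA->|]; rewrite ?cards1.
Qed.

(** In coordinate i the edge between the values a and b is given as a colour the
    whole vector of colours of the edges from a to b over the vertices of the box
    already chosen.  There are at most t^d such vertices, hence r^(t^d) vectors, and
    [monotone_ramsey] needs (r^(t^d))^t = r^(t^(d+1)) values of coordinate i. *)
Lemma monotone_box d N r (col : {set vertex d N} -> 'I_r) t :
    1 < r -> 0 < t -> (r ^ t ^ d.+1) ^ (t.+1 ^ d.-1) <= N ->
  exists A : {ffun 'I_d -> {set 'I_N}}, (forall k, #|A k| = t) /\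
    forall i w b b', w \in box A -> b \in A i -> b' \in A i ->
      w i < b -> w i < b' ->
      col [set w; upd w i b] = col [set w; upd w i b'].
Proof.
move=> r_gt1 t_gt0; set m := r ^ t ^ d.+1 => mN.
have m_gt0 : 0 < m by rewrite expn_gt0 ltnW.
have N_gt0 : 0 < N by apply: leq_trans mN; rewrite expn_gt0 m_gt0.
have /fin_all_exists[D cD] (i : 'I_d) :
    exists D : {set 'I_N}, #|D| = m ^ (t.+1 ^ i).
  have [|D _ cD] := @subset_of_card _ [set: 'I_N] (m ^ (t.+1 ^ i)).
    rewrite cardsT card_ord; apply: leq_trans mN; apply: leq_pexp2l => //.
    by apply: leq_pexp2l => //; move: (ltn_ord i); lia.
  by exists D.
pose P j (u : vertex d N) (A : {ffun 'I_d -> {set 'I_N}}) :=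
  forall (i : 'I_d) w b b', i < j -> w \in subcube j A u -> b \in A i -> b' \in A i ->
    w i < b -> w i < b' -> col [set w; upd w i b] = col [set w; upd w i b'].
have [//|i u A S SD mS fA PS|A [fA PA]] :=
    @sequential_choice d N t m D P m_gt0 cD _ _ [ffun=> Ordinal N_gt0]; last first.
  exists A; split=> [k|i w b b' wA]; first by case: (fA k).
  by apply: PA; rewrite ?subcube_all.
(* The set W of base vertices has u i as its i-th coordinate, which f overwrites. *)
pose W := subcube i A u.
have cW : #|W| <= t ^ d by apply: subcube_card => // k /fA[].
pose f a b := [ffun w : {w | w \in W} =>
  col [set upd (val w) i a; upd (val w) i b]].
have [| | |/= X [XS cX homX]] := @monotone_ramsey N _ f (r ^ t ^ d) t S.
- by rewrite -{1}(expn0 r) ltn_exp2l // expn_gt0 t_gt0.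
- by rewrite card_ffun card_ord card_sig leq_exp2l // cW.
- by rewrite -expnM -expnSr.
exists X; split=> // j w b b'; rewrite ltnS leq_eqVlt => ji /subcube_upd[wX wA].
have upd_id (x : 'I_N) : upd (upd w i (u i)) i x = upd w i x.
  by apply/ffunP => k; rewrite !ffunE; case: eqP.
have wE : upd w i (w i) = w by apply/ffunP => k; rewrite ffunE; case: eqP => [->|].
rewrite ffunE -val_eqE /=; case: eqP ji => [/val_inj -> _ bX bX'|_ /= ji bA bA']; last first.
  exact: (PS (w i)) (subsetP XS _ wX) _ _ _ _ ji wA bA bA'.
move=> /(homX _ _ _ wX bX bX') E /E {E} /ffunP.
have w0W : upd w i (u i) \in W.
  apply/subcubeP => k; move/subcubeP/(_ k): wA; rewrite !ffunE.
  by case: (eqVneq k i) => [->|]; rewrite ?ltnn ?inE.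
by move/(_ (exist (fun w => w \in W) _ w0W)); rewrite !ffunE /= !upd_id wE.
Qed.

(** A Ramsey theorem for vertex colourings of a grid.  In coordinate i the box
    chosen so far has one label for each value of that coordinate, and at least
    a fraction 1/#|L| of the values share it. *)
Lemma constant_subbox d N (L : finType) (lab : vertex d N -> L) n
    (B : 'I_d -> {set 'I_N}) :
    0 < n -> (forall k, (#|L| * n) ^ (n.+1 ^ d.-1) <= #|B k|) -> 0 < #|L| ->
    0 < d ->
  exists A : {ffun 'I_d -> {set 'I_N}},
    (forall k, A k \subset B k /\ #|A k| = n) /\
    exists q, forall w, w \in box A -> lab w = q.
Proof.
move=> n_gt0; set m := #|L| * n => mB L_gt0 d_gt0.
have m_gt0 : 0 < m by rewrite muln_gt0 L_gt0.
have /fin_all_exists[D DP] (i : 'I_d) : exists D : {set 'I_N},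
    D \subset B i /\ #|D| = m ^ (n.+1 ^ i).
  have [|D DB cD] := @subset_of_card _ (B i) (m ^ (n.+1 ^ i)).
    apply: leq_trans (mB i); apply: leq_pexp2l => //.
    by apply: leq_pexp2l => //; move: (ltn_ord i); lia.
  by exists D.
have /card_gt0P[x0 _] : 0 < #|B (Ordinal d_gt0)|.
  by apply: leq_trans (mB _); rewrite expn_gt0 m_gt0.
pose P j (u : vertex d N) (A : {ffun 'I_d -> {set 'I_N}}) :=
  exists q, forall w, w \in subcube j A u -> lab w = q.
have [i|u A|i u A S SD mS fA|A [fA PA]] :=
    @sequential_choice d N n m D P m_gt0 _ _ _ [ffun=> x0].
- by case: (DP i).
- exists (lab u) => w /subcubeP wu; congr lab; apply/ffunP => k.
  by move: (wu k); rewrite ltn0 => /set1P.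
- have [q0 _] := card_gt0P L_gt0.
  move=> PS; have /fin_all_exists[q qP] (x : 'I_N) : exists q, x \in S ->
      forall w, w \in subcube i A (upd u i x) -> lab w = q.
    have [/PS[q qP]|_] := boolP (x \in S); last by exists q0.
    by exists q.
  have [|y _ yS] := @pigeonhole _ _ q S [set: L] n.-1 (fun x _ => in_setT _).
    rewrite cardsT; apply: leq_trans mS; rewrite /m -[in X in _ < X](prednK n_gt0).
    by rewrite mulnS; lia.
  rewrite prednK // in yS.
  have [X XS cX] := subset_of_card yS.
  have XP x : x \in X -> x \in S /\ q x = y.
    by move/(subsetP XS); rewrite inE => /andP[-> /eqP].
  exists X; split=> //; first by apply/subsetP => x /XP[].
  by exists y => w /subcube_upd[/XP[wS <-] wA]; apply: qP.
exists A; split=> [k|].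
  by case: (fA k) (DP k) => AD -> [DB _]; split=> //; apply: subset_trans DB.
by case: PA => q qP; exists q => w wA; apply: qP; rewrite subcube_all.
Qed.

(** The side t of the monotone box in which [constant_subbox], applied with the
    r^d vectors of colours as labels, finds a sub-box of side n. *)
Definition monotone_side d r n := (r ^ d * n) ^ (n.+1 ^ d.-1).

Definition canonical_side d r n :=
  let t := monotone_side d r n in (r ^ t ^ d.+1) ^ (t.+1 ^ d.-1).

Lemma canonical_box d N r (col : {set vertex d N} -> 'I_r) n :
    1 < r -> 0 < n -> 0 < d -> canonical_side d r n <= N ->
  exists (A : {ffun 'I_d -> {set 'I_N}}) (kappa : 'I_d -> 'I_r),
    (forall k, #|A k| = n) /\
    forall u v i, u \in box A -> v \in box A ->
      (forall k, (u k != v k) = (k == i)) -> col [set u; v] = kappa i.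
Proof.
move=> r_gt1 n_gt0 d_gt0; rewrite /canonical_side; set t := monotone_side d r n => tN.
have t_gt0 : 0 < t by rewrite expn_gt0 muln_gt0 expn_gt0 (ltnW r_gt1) n_gt0.
have [B [cB monoB]] := @monotone_box d N r col t r_gt1 t_gt0 tN.
(* At a maximal value of coordinate i there is no edge going up; any entry will do. *)
pose lab (w : vertex d N) := [ffun i => 
  if [pick b in B i | w i < b] is Some b then col [set w; upd w i b]
  else col [set w]].
have cL : #|{ffun 'I_d -> 'I_r}| = r ^ d by rewrite card_ffun !card_ord.
have [k||A [AP [q labq]]] := @constant_subbox d N _ lab n B n_gt0 _ _ d_gt0.
- by rewrite cB cL.
- by rewrite cL expn_gt0 ltnW.
exists A, (fun i => q i); split=> [k|]; first by case: (AP k).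
have AB w k : w \in box A -> w k \in B k.
  by rewrite inE => /forallP/(_ k); apply/subsetP; case: (AP k).
have up u v i : u \in box A -> v \in box A ->
    (forall k, (u k != v k) = (k == i)) -> u i < v i -> col [set u; v] = q i.
  move=> uA vA uv uvi; have -> : v = upd u i (v i).
    apply/ffunP => k; rewrite ffunE; case: (eqVneq k i) (uv k) => [->//|_].
    by move/negbFE/eqP.
  rewrite -(labq u uA) ffunE; case: pickP => [b /andP[bB ub]|/(_ (v i))].
    apply: monoB => //; last exact: AB.
    by rewrite inE; apply/forallP => k; apply: AB.
  by rewrite AB // uvi.
move=> u v i uA vA uv; have := uv i; rewrite eqxx -val_eqE neq_ltn => /orP[]; first exact: up.
by rewrite setUC; apply: up => // k; rewrite eq_sym.
Qed.


(** * Monochromatic copies *)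

Lemma adjacent_direction d N (u v : vertex d N) :
  adjacent u v -> exists i, forall k, (u k != v k) = (k == i).
Proof.
by case/cards1P => i uv; exists i => k; move/setP/(_ k): uv; rewrite !inE.
Qed.

(** The hypothesis r l < d + r says that l <= ceil(d/r), so some colour is taken by
    kappa on l directions; the copy varies in these and is constant in the rest,
    which leaves only edges of that colour. *)
Lemma mono_copy_of_canonical d N r l n (c : coloring d N r)
    (A : {ffun 'I_d -> {set 'I_N}}) (kappa : 'I_d -> 'I_r) :
    0 < n -> r * l < d + r -> (forall k, #|A k| = n) ->
    (forall e : edge d N, forall u v i, u \in box A -> v \in box A -> 
      val e = [set u; v] ->
      (forall k, (u k != v k) = (k == i)) -> c e = kappa i) ->
  exists2 S : {set vertex d N}, is_copy l n S & monochromatic c S.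
Proof.
move=> n_gt0 rl cA ck.
have [I [a [kI cI]]] : exists (I : {set 'I_d}) (a : option 'I_r),
    (forall i, i \in I -> Some (kappa i) = a) /\ #|I| = l.
  (* For l = 0 no colour is needed, and there may be none. *)
  case: l rl => [|l] rl.
    by exists set0, None; rewrite cards0; split=> // i; rewrite inE.
  have [|a _ la] := @pigeonhole _ _ kappa [set: 'I_d] [set: 'I_r] l (fun x _ => in_setT _).
    by rewrite !cardsT !card_ord; move: rl; rewrite mulnS; lia.
  have [I IS cI] := subset_of_card la; exists I, (Some a); split=> // i.
  by move/(subsetP IS); rewrite !inE => /= /eqP->.
have /fin_all_exists[x xA] (i : 'I_d) : exists x, x \in A i.
  by apply/card_gt0P; rewrite cA.
pose A' i := if i \in I then A i else [set x i].
exists (box A').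
  by exists I, A'; split=> // i; rewrite /A'; case: ifP; rewrite ?cards1 ?cA.
have color_edge (e : edge d N) : val e \subset box A' -> Some (c e) = a.
  have /imsetP[[u v] /= uv eE] := valP e; rewrite eE => /subsetP eA.
  have {}uv : adjacent u v by move: uv; rewrite inE.
  have inA' w : w \in [set u; v] -> forall k, w k \in A' k.
    by move/eA; rewrite inE => /forallP.
  have inA w : w \in [set u; v] -> w \in box A.
    move/inA' => wA'; rewrite inE; apply/forallP => k; move: (wA' k).
    by rewrite /A'; case: ifP => // _ /set1P->.
  have [i uvi] := adjacent_direction uv.
  rewrite (ck e u v i) ?inA ?set21 ?set22 //; apply: kI.
  apply: contraT => iI; move: (uvi i); rewrite eqxx.
  have := inA' u (set21 _ _) i; have := inA' v (set22 _ _) i.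
  by rewrite /A' (negPf iI) => /set1P-> /set1P->; rewrite eqxx.
by move=> e f /color_edge ea /color_edge; rewrite -ea => -[].
Qed.

Lemma mono_copy_large d N r l n (c : coloring d N r) :
    1 < r -> 0 < n -> 0 < d -> r * l < d + r ->
    canonical_side d r n <= N ->
  exists2 S : {set vertex d N}, is_copy l n S & monochromatic c S.
Proof.
move=> r_gt1 n_gt0 d_gt0 rl tN.
pose col (e : {set vertex d N}) : 'I_r :=
  if insub e is Some e' then c e' else Ordinal (ltnW r_gt1).
have [A [kappa [cA kappaP]]] := canonical_box col r_gt1 n_gt0 d_gt0 tN.
apply: (mono_copy_of_canonical (A := A) (kappa := kappa)) => // e u v i uA vA eE uv.
by rewrite -(kappaP u v i uA vA uv) -eE /col valK.
Qed.

Lemma mono_copy_single_color d N n (c : coloring d N 1) : n <= N ->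
  exists2 S : {set vertex d N}, is_copy d n S & monochromatic c S.
Proof.
move=> nN; have [|X _ cX] := @subset_of_card _ [set: 'I_N] n.
  by rewrite cardsT card_ord.
exists (box (fun=> X)); last by move=> e f _ _; rewrite [c e]ord1 [c f]ord1.
by exists [set: 'I_d], (fun=> X); split=> [|i|]; rewrite ?cardsT ?card_ord ?inE.
Qed.

(** The colouring by the direction modulo r.  A copy has an edge in each of its
    directions because n >= 2, so its directions are congruent modulo r and i |->
    i %/ r embeds them into 'I_l. *)
Lemma mono_copy_dim_le d N r l l' n : 0 < r -> 1 < n -> d <= r * l ->
  every_coloring_has_mono_copy d N r l' n -> l' <= l.
Proof.
move=> r_gt0 n_gt1 drl.
pose dir (e : {set vertex d N}) :=
  [pick i | [exists u in e, exists v in e, u i != v i]].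
pose c (e : edge d N) : 'I_r :=
  Ordinal (ltn_pmod (if dir (val e) is Some i then val i else 0) r_gt0).
move=> /(_ c) [S [I [A [<- cA SE]]] mono].
have /fin_all_exists[x xA] (i : 'I_d) : exists x, x \in A i.
  by apply/card_gt0P; rewrite cA; case: ifP => // _; apply: ltnW.
have edge_in i : i \in I -> exists2 e : edge d N, val e \subset S & c e = i %% r :> nat.
  move=> iI; have /card_gt1P[a [b [aA bA ab]]] : 1 < #|A i| by rewrite cA iI.
  pose w : vertex d N := finfun x; pose u := upd w i a; pose v := upd w i b.
  have uv k : (u k != v k) = (k == i).
    by rewrite !ffunE; case: (eqVneq k i) => // _; rewrite eqxx.
  have adj : adjacent u v.
    by apply/cards1P; exists i; apply/setP => k; rewrite !inE uv.
  have eP : [set u; v] \in edges d N.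
    by apply/imsetP; exists (u, v); rewrite ?inE.
  exists (Sub [set u; v] eP); rewrite SubK.
    apply/subsetP => z; rewrite !inE SE inE => /orP[] /eqP->; apply/forallP => k;
    by rewrite !ffunE; case: eqP => [->|].
  rewrite /c SubK /= /dir; case: pickP => [k|/(_ i)]; last first.
    move/negbT/negP; case; apply/exists_inP; exists u; rewrite ?set21 //.
    by apply/exists_inP; exists v; rewrite ?set22 // uv.
  case/exists_inP => y + /exists_inP[z]; rewrite !inE.
  by case/orP => /eqP-> /orP[] /eqP->; rewrite ?eqxx //
    1?[u k == v k]eq_sym 1?eq_sym uv => /eqP->.
have div_lt (i : 'I_d) : i %/ r < l.
  by rewrite ltn_divLR // mulnC; apply: leq_trans drl.
rewrite -[l in _ <= l]card_ord.
apply: (@leq_card_in _ _ (fun i => Ordinal (div_lt i)) (mem I)) => i j iI jI [ij].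
have [e eS ei] := edge_in i iI; have [f fS fj] := edge_in j jI.
by apply/val_inj; rewrite /= (divn_eq i r) (divn_eq j r) ij -ei -fj (mono e f).
Qed.

(** * The size of the grid *)

(** The constant C_d.  With t = [monotone_side] the exponent of r in [canonical_side] is
    t^(d+1) (t+1)^(d-1) <= t^(3d), while t is at most r to the power
    (d+n) (n+1)^(d-1) <= (d+1) n (2n)^(d-1). *)
Definition tower_const d := 3 * d * d.+1 * 2 ^ d.-1.

Lemma tower_bound d r n : 1 < r -> 0 < n -> 0 < d ->
  canonical_side d r n <= r ^ r ^ (tower_const d * n ^ d).
Proof.
move=> r_gt1 n_gt0 d_gt0; have r_gt0 := ltnW r_gt1.
rewrite /canonical_side /monotone_side; set t := (_ * n) ^ _.
have powl a b e : a <= b -> a ^ e <= b ^ e by case: e => // e ab; rewrite leq_exp2r.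
have t_gt1 : 1 < t.
  rewrite /t -[1](exp1n (n.+1 ^ d.-1)) ltn_exp2r ?expn_gt0 //.
  apply: (@leq_trans (r ^ d)); last by rewrite leq_pmulr.
  by rewrite -{1}(expn0 r) ltn_exp2l.
rewrite -expnM leq_exp2l //.
have tt : t.+1 <= t ^ 2 by rewrite expnS expn1; nia.
apply: (@leq_trans (t ^ (3 * d))).
  apply: (@leq_trans (t ^ d.+1 * (t ^ 2) ^ d.-1)).
    by rewrite leq_mul2l powl ?orbT.
  by rewrite -expnM -expnD leq_exp2l //; lia.
have tr : t <= r ^ ((d + n) * n.+1 ^ d.-1).
  rewrite expnM; apply: powl; rewrite expnD leq_mul2l.
  by rewrite (ltnW (ltn_expl n r_gt1)) orbT.
apply: (@leq_trans ((r ^ ((d + n) * n.+1 ^ d.-1)) ^ (3 * d))).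
  exact: powl.
rewrite -expnM leq_exp2l // /tower_const.
have dn : d + n <= d.+1 * n by nia.
have nd : n.+1 ^ d.-1 <= 2 ^ d.-1 * n ^ d.-1.
  by rewrite -expnMn; apply: powl; lia.
apply: (@leq_trans (d.+1 * n * (2 ^ d.-1 * n ^ d.-1) * (3 * d))).
  by rewrite leq_mul2r leq_mul ?orbT.
have -> : n ^ d = n * n ^ d.-1 by rewrite -expnS prednK.
by move: (2 ^ _) (n ^ _) => x y; nia.
Qed.

End Boxes.

Lemma ceil_div_bounds (R : realType) (d r l : nat) : (0 < r)%N ->
  l%:Z = Num.ceil (d%:R / r%:R : R) -> (d <= r * l)%N /\ (r * l < d + r)%N.
Proof.
move=> r_gt0 lE; have r0 : 0 < r%:R :> R by rewrite ltr0n.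
have := ceil_itv (d%:R / r%:R : R); rewrite -lE intrB => /andP[].
rewrite ltr_pdivlMr // ler_pdivrMr // => h1 h2; split.
  by rewrite mulnC -(ler_nat R) natrM.
rewrite -(ltr_nat R) natrM natrD; move: h1; rewrite mulrBl mul1r ltrBlDr.
by rewrite mulrC.
Qed.

Lemma powR_tower_nat (R : realType) (r k : nat) :
  r%:R `^ (r%:R `^ k%:R) = (r ^ r ^ k)%:R :> R.
Proof. by rewrite powR_mulrn // -natrX powR_mulrn // -natrX. Qed.

Theorem corollary1p2 (R : realType) (d : nat) (hd : (0 < d)%N) :
  exists2 C : R, 0 < C &
    forall (n r l : nat), (0 < n)%N -> (0 < r)%N ->
      l%:Z = Num.ceil (d%:R / r%:R : R) ->
      (forall N : nat,
          r%:R `^ (r%:R `^ (C * r%:R * n%:R ^+ d)) <= N%:R :> R ->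
          (r = 1%N -> (n <= N)%N) ->
          every_coloring_has_mono_copy d N r l n)
      /\
      ((1 < n)%N ->
        forall N l' : nat,
          every_coloring_has_mono_copy d N r l' n -> (l' <= l)%N).
Proof.
exists (tower_const d)%:R.
  by rewrite ltr0n /tower_const !muln_gt0 expn_gt0 hd.
move=> n r l n_gt0 r_gt0 /(ceil_div_bounds r_gt0)[drl rld]; split; last first.
  by move=> n_gt1 N l'; apply: mono_copy_dim_le.
move=> N NR n_le c; have [r_gt1|r_le1] := ltnP 1 r.
  apply: mono_copy_large => //; apply: leq_trans (tower_bound r_gt1 n_gt0 hd) _.
  rewrite -natrX -!natrM powR_tower_nat ler_nat in NR; apply: leq_trans NR.
  rewrite leq_exp2l // leq_exp2l // -mulnA leq_mul2l.
  by rewrite leq_pmull ?orbT.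
have r1 : r = 1%N by apply/eqP; rewrite eqn_leq r_le1.
move: n_le (n_le r1) => _; rewrite {}r1 in c drl rld * => nN.
have -> : l = d by move: drl rld; lia.
exact: mono_copy_single_color.
Qed.
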